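(* Let $\mathbf{C}$ be a dagger category, let $D\colon\mathbf{J}\to\mathbf{C}$ be a functor and let $\Omega$ be a weakly initial class of objects of $\mathbf{J}$. Let $L$, with cone $(l_A\colon L\to D(A))_{A\in\mathbf{J}}$, be a dagger limit of $(D,\Omega)$, and let $M$, with cone $(m_A\colon M\to D(A))_{A\in\mathbf{J}}$, be a limit of $D$. Then the canonical isomorphism of cones $L\to M$ (the unique $f\colon L\to M$ with $m_A f=l_A$ for all $A$) is unitary if and only if $M$ (with the cone $(m_A)$) is a dagger limit of $(D,\Omega)$. In particular, the dagger limit of $(D,\Omega)$ is defined up to unitary isomorphism.
   Context: A dagger category is a category $\mathbf{C}$ equipped with a functor $\dagger\colon\mathbf{C}^{\mathrm{op}}\to\mathbf{C}$ that is the identity on objects and satisfies $f^{\dagger\dagger}=f$. A morphism $f\colon A\to B$ is unitary if $f^\dagger f=\mathrm{id}_A$ and $ff^\dagger=\mathrm{id}_B$; it is a partial isometry if $f=ff^\dagger f$. A class $\Omega$ of objects of a category $\mathbf{J}$ is weakly initial if for every object $B$ of $\mathbf{J}$ there is a morphism $A\to B$ with $A\in\Omega$. Given a functor $D\colon\mathbf{J}\to\mathbf{C}$ into a dagger category and a weakly initial $\Omega$, a dagger limit of $(D,\Omega)$ is a limit $L$ of $D$ whose cone $l_A\colon L\to D(A)$ satisfies: (normalization) $l_A$ is a partial isometry for every $A\in\Omega$; (independence) $l_A^\dagger l_A l_B^\dagger l_B=l_B^\dagger l_B l_A^\dagger l_A$ for all $A,B\in\Omega$. *)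

(* Defs.v *)
Set Implicit Arguments.
Unset Strict Implicit.
Unset Printing Implicit Defensive.

Record Category := {
  Ob :> Type;
  Hom : Ob -> Ob -> Type;
  id : forall A, Hom A A;
  comp : forall A B C, Hom B C -> Hom A B -> Hom A C;
  comp_id_l : forall A B (f : Hom A B), comp (id B) f = f;
  comp_id_r : forall A B (f : Hom A B), comp f (id A) = f;
  comp_assoc : forall A B C D (h : Hom C D) (g : Hom B C) (f : Hom A B),
    comp h (comp g f) = comp (comp h g) f
}.
Arguments Hom {c} A B.
Arguments id {c} A.
Arguments comp {c A B C} g f.

Declare Scope cat_scope.
Delimit Scope cat_scope with cat.
Notation "g ∘ f" := (comp g f) (at level 40, left associativity) : cat_scope.
Local Open Scope cat_scope.

Record Functor (J C : Category) := {
  fobj :> J -> C;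
  fmap : forall A B : J, Hom A B -> Hom (fobj A) (fobj B);
  fmap_id : forall A : J, fmap (id A) = id (fobj A);
  fmap_comp : forall (A B E : J) (g : Hom B E) (f : Hom A B),
    fmap (g ∘ f) = fmap g ∘ fmap f
}.
Arguments fmap {J C} F {A B} f : rename.

(* Being the identity on objects is built into the type of [dag];
   [dag_id] and [dag_comp] are contravariant functoriality. *)
Record DaggerCategory := {
  dcat :> Category;
  dag : forall A B : dcat, Hom A B -> Hom B A;
  dag_id : forall A : dcat, dag (id A) = id A;
  dag_comp : forall (A B E : dcat) (g : Hom B E) (f : Hom A B),
    dag (g ∘ f) = dag f ∘ dag g;
  dag_invol : forall (A B : dcat) (f : Hom A B), dag (dag f) = f
}.
Arguments dag {d A B} f.

Definition isomorphism (C : Category) (A B : C) (f : Hom A B) : Prop :=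
  exists g : Hom B A, g ∘ f = id A /\ f ∘ g = id B.

Definition unitary (C : DaggerCategory) (A B : C) (f : Hom A B) : Prop :=
  dag f ∘ f = id A /\ f ∘ dag f = id B.

Definition partial_isometry (C : DaggerCategory) (A B : C) (f : Hom A B)
    : Prop :=
  f = f ∘ dag f ∘ f.

Definition weakly_initial (J : Category) (Omega : J -> Prop) : Prop :=
  forall B : J, exists A : J, Omega A /\ inhabited (Hom A B).

Section Limits.
Variables (J C : Category) (D : Functor J C).

Definition is_cone (L : C) (l : forall A : J, Hom L (D A)) : Prop :=
  forall (A B : J) (h : Hom A B), fmap D h ∘ l A = l B.

Definition cone_morphism (L M : C) (l : forall A : J, Hom L (D A))
    (m : forall A : J, Hom M (D A)) (f : Hom L M) : Prop :=
  forall A : J, m A ∘ f = l A.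

Definition is_limit (L : C) (l : forall A : J, Hom L (D A)) : Prop :=
  is_cone l /\
  forall (X : C) (x : forall A : J, Hom X (D A)),
    is_cone x -> exists! f : Hom X L, cone_morphism x l f.
End Limits.

Definition is_dagger_limit (J : Category) (C : DaggerCategory)
    (D : Functor J C) (Omega : J -> Prop) (L : C)
    (l : forall A : J, Hom L (D A)) : Prop :=
  is_limit l /\
  (forall A : J, Omega A -> partial_isometry (l A)) /\
  (forall A B : J, Omega A -> Omega B ->
     (dag (l A) ∘ l A) ∘ (dag (l B) ∘ l B)
     = (dag (l B) ∘ l B) ∘ (dag (l A) ∘ l A)).

(* Main.v *)
Require Import Defs.
From Stdlib Require Import Setoid.

(** The canonical comparison [f : L -> M] is invertible because both cones are
    limits.  If [f] is unitary, then [m A = l A ∘ dag f], and normalization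
    and independence are visibly preserved by a unitary change of apex.

    Conversely, let both cones be dagger limits.  It is enough to show that
    [dag f] is also a cone morphism from [m] to [l], for then it is the inverse
    of [f].  By weak initiality this need only be checked on the legs indexed
    by [Omega], and after taking daggers and composing with the jointly monic
    cone [m] it becomes the equality of overlaps
    [[
      l B ∘ dag (l A) = m B ∘ dag (m A)     for A, B in Omega.
    ]]
    So everything reduces to showing that the overlaps of two legs do not
    depend on the chosen dagger limit.  Since [l A = m A ∘ f] with [f]
    invertible, [l A] and [m A] have the same range, hence the same range
    projection: this is the case [A = B] ([range_projection_eq]).  In general,
    independence makes each overlap a partial isometry, and lets each overlap
    absorb the other one ([overlap_absorb]): with [p] and [q] the two overlaps,
    [q ∘ dag q ∘ p = q], and so on by symmetry.  Partial isometries that absorb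
    each other in this way coincide ([partial_isometry_antisym]). *)

Set Implicit Arguments.
Unset Strict Implicit.

Local Open Scope cat_scope.

(** * Cones and limits *)

Lemma limit_jointly_monic (J C : Category) (D : Functor J C) (L : C)
    (l : forall A : J, Hom L (D A)) (X : C) (u v : Hom X L) :
  is_limit l -> (forall A, l A ∘ u = l A ∘ v) -> u = v.
Proof.
  intros [cone_l univ] uv.
  destruct (univ X (fun A => l A ∘ v)) as [w [_ w_uniq]].
  - intros A B h. now rewrite comp_assoc, cone_l.
  - transitivity w; [symmetry|]; apply w_uniq; intro A; [apply uv|reflexivity].
Qed.

Lemma cone_eq_weakly_initial (J C : Category) (D : Functor J C)
    (Omega : J -> Prop) (X : C) (x y : forall A : J, Hom X (D A)) :
  weakly_initial Omega -> is_cone x -> is_cone y ->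
  (forall A, Omega A -> x A = y A) -> forall A, x A = y A.
Proof.
  intros winit cone_x cone_y xy B.
  destruct (winit B) as [A [OA [h]]].
  now rewrite <- (cone_x A B h), <- (cone_y A B h), (xy A OA).
Qed.

Lemma is_cone_comp (J C : Category) (D : Functor J C) (L X : C)
    (l : forall A : J, Hom L (D A)) (u : Hom X L) :
  is_cone l -> is_cone (fun A => l A ∘ u).
Proof.
  intros cone_l A B h. now rewrite comp_assoc, cone_l.
Qed.

Lemma limit_comparison (J C : Category) (D : Functor J C) (L M : C)
    (l : forall A : J, Hom L (D A)) (m : forall A : J, Hom M (D A)) :
  is_limit l -> is_limit m ->
  exists (f : Hom L M) (g : Hom M L),
    unique (fun f' => cone_morphism l m f') f /\ cone_morphism m l g /\
    g ∘ f = id L /\ f ∘ g = id M.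
Proof.
  intros lim_l lim_m.
  destruct (proj2 lim_m L l (proj1 lim_l)) as [f [mf f_uniq]].
  destruct (proj2 lim_l M m (proj1 lim_m)) as [g [lg _]].
  exists f, g. repeat split; trivial.
  - apply (limit_jointly_monic lim_l). intro A.
    now rewrite comp_assoc, lg, mf, comp_id_r.
  - apply (limit_jointly_monic lim_m). intro A.
    now rewrite comp_assoc, mf, lg, comp_id_r.
Qed.

(** * Partial isometries *)

Section PartialIsometries.
Variable C : DaggerCategory.

Lemma partial_isometry_dag (A B : C) (p : Hom A B) :
  partial_isometry p -> partial_isometry (dag p).
Proof.
  unfold partial_isometry. intro Hp.
  rewrite Hp at 1. now rewrite !dag_comp, !dag_invol, comp_assoc.
Qed.

Lemma range_projection_absorb (L M A : C) (l : Hom L A) (m : Hom M A)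
    (f : Hom L M) :
  partial_isometry m -> m ∘ f = l -> m ∘ dag m ∘ (l ∘ dag l) = l ∘ dag l.
Proof.
  unfold partial_isometry. intros Hm <-.
  now rewrite !comp_assoc, <- Hm.
Qed.

(** Two projections that absorb each other on the left are equal, because
    they are self-adjoint; factorizations both ways say that [l] and [m] have
    the same range. *)
Lemma range_projection_eq (L M A : C) (l : Hom L A) (m : Hom M A)
    (f : Hom L M) (g : Hom M L) :
  partial_isometry l -> partial_isometry m -> m ∘ f = l -> l ∘ g = m ->
  l ∘ dag l = m ∘ dag m.
Proof.
  intros Hl Hm mf lg.
  pose proof (range_projection_absorb Hm mf) as absorb_l.
  apply (f_equal (fun h => dag h)) in absorb_l.
  rewrite !dag_comp, !dag_invol in absorb_l.
  rewrite <- absorb_l. exact (range_projection_absorb Hl lg).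
Qed.

(** On the apex [M], independence lets the two support projections in
    [q ∘ dag q ∘ (lB ∘ dag lA)], for [q := mB ∘ dag mA], trade places; then the
    projection of [mB] is swallowed by [mB], while the projection of [mA] meets
    [f ∘ dag lA] and produces the common range projection of [lA] and [mA].
    Taking [f := id M] shows that [q] itself is a partial isometry. *)
Lemma overlap_absorb (L M A B : C) (lA : Hom L A) (lB : Hom L B)
    (mA : Hom M A) (mB : Hom M B) (f : Hom L M) :
  mA ∘ f = lA -> mB ∘ f = lB ->
  partial_isometry mA -> partial_isometry mB ->
  lA ∘ dag lA = mA ∘ dag mA ->
  (dag mA ∘ mA) ∘ (dag mB ∘ mB) = (dag mB ∘ mB) ∘ (dag mA ∘ mA) ->
  mB ∘ dag mA ∘ dag (mB ∘ dag mA) ∘ (lB ∘ dag lA) = mB ∘ dag mA.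
Proof.
  unfold partial_isometry. intros fA fB HA HB range comm.
  rewrite dag_comp, dag_invol, <- fB.
  transitivity
    (mB ∘ ((dag mA ∘ mA) ∘ (dag mB ∘ mB)) ∘ (f ∘ dag lA)).
  { now rewrite !comp_assoc. }
  rewrite comm.
  transitivity ((mB ∘ dag mB ∘ mB) ∘ dag mA ∘ ((mA ∘ f) ∘ dag lA)).
  { now rewrite !comp_assoc. }
  rewrite <- HB, fA, range.
  transitivity (mB ∘ (dag mA ∘ dag (dag mA) ∘ dag mA)).
  { now rewrite dag_invol, !comp_assoc. }
  now rewrite <- (partial_isometry_dag HA).
Qed.

Lemma overlap_partial_isometry (M A B : C) (mA : Hom M A) (mB : Hom M B) :
  partial_isometry mA -> partial_isometry mB ->
  (dag mA ∘ mA) ∘ (dag mB ∘ mB) = (dag mB ∘ mB) ∘ (dag mA ∘ mA) ->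
  partial_isometry (mB ∘ dag mA).
Proof.
  intros HA HB comm. symmetry.
  apply (overlap_absorb (f := id M)); trivial; apply comp_id_r.
Qed.

(** Absorption on the support side gives [q ∘ dag q = p ∘ dag q] and
    [p ∘ dag p = q ∘ dag p].  A range projection is self-adjoint, so the first
    is also [q ∘ dag p]; hence [p] and [q] have the same range projection, which
    the absorption on the range side turns into [q = p]. *)
Lemma partial_isometry_antisym (A B : C) (p q : Hom A B) :
  partial_isometry p -> partial_isometry q ->
  q ∘ dag q ∘ p = q -> p ∘ dag q ∘ q = q -> q ∘ dag p ∘ p = p ->
  p = q.
Proof.
  unfold partial_isometry. intros Hp Hq qqp pqq qpp.
  pose proof (partial_isometry_dag Hp) as Hp'.
  pose proof (partial_isometry_dag Hq) as Hq'.
  unfold partial_isometry in Hp', Hq'. rewrite dag_invol in Hp', Hq'.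
  assert (E1 : q ∘ dag q = p ∘ dag q).
  { rewrite <- pqq at 1. rewrite Hq' at 3. now rewrite !comp_assoc. }
  assert (E2 : p ∘ dag p = q ∘ dag p).
  { rewrite <- qpp at 1. rewrite Hp' at 3. now rewrite !comp_assoc. }
  assert (E3 : q ∘ dag q = q ∘ dag p).
  { rewrite <- (dag_invol (q ∘ dag q)), dag_comp, dag_invol, E1.
    now rewrite dag_comp, dag_invol. }
  rewrite <- qqp, E3, <- E2. exact Hp.
Qed.

Lemma overlap_eq (L M A B : C) (lA : Hom L A) (lB : Hom L B)
    (mA : Hom M A) (mB : Hom M B) (f : Hom L M) (g : Hom M L) :
  mA ∘ f = lA -> mB ∘ f = lB -> lA ∘ g = mA -> lB ∘ g = mB ->
  partial_isometry lA -> partial_isometry lB ->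
  partial_isometry mA -> partial_isometry mB ->
  (dag lA ∘ lA) ∘ (dag lB ∘ lB) = (dag lB ∘ lB) ∘ (dag lA ∘ lA) ->
  (dag mA ∘ mA) ∘ (dag mB ∘ mB) = (dag mB ∘ mB) ∘ (dag mA ∘ mA) ->
  lB ∘ dag lA = mB ∘ dag mA.
Proof.
  intros fA fB gA gB HlA HlB HmA HmB comm_l comm_m.
  pose proof (range_projection_eq HlA HmA fA gA) as rangeA.
  pose proof (range_projection_eq HlB HmB fB gB) as rangeB.
  apply partial_isometry_antisym.
  - now apply overlap_partial_isometry.
  - now apply overlap_partial_isometry.
  - now apply (overlap_absorb (f := f)).
  (* Absorption on the support side is absorption on the range side for the
     reversed overlaps. *)
  - pose proof (overlap_absorb fB fA HmB HmA rangeB (eq_sym comm_m)) as E.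
    apply (f_equal (fun h => dag h)) in E.
    rewrite !dag_comp, !dag_invol in E.
    now rewrite !dag_comp, !dag_invol, <- comp_assoc.
  - pose proof (overlap_absorb gB gA HlB HlA (eq_sym rangeB)
      (eq_sym comm_l)) as E.
    apply (f_equal (fun h => dag h)) in E.
    rewrite !dag_comp, !dag_invol in E.
    now rewrite !dag_comp, !dag_invol, <- comp_assoc.
Qed.

End PartialIsometries.

(** * Dagger limits and unitary comparisons *)

Section Comparison.
Variables (J : Category) (C : DaggerCategory) (D : Functor J C).
Variable Omega : J -> Prop.
Variables (L M : C).
Variables (l : forall A : J, Hom L (D A)) (m : forall A : J, Hom M (D A)).
Variable f : Hom L M.
Hypothesis mf : cone_morphism l m f.

Lemma dagger_limit_of_unitary :
  unitary f -> is_dagger_limit Omega l -> is_limit m ->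
  is_dagger_limit Omega m.
Proof.
  intros [ff1 ff2] [_ [norm indep]] lim_m.
  assert (lf : forall A, m A = l A ∘ dag f).
  { intro A. now rewrite <- (mf A), <- comp_assoc, ff2, comp_id_r. }
  assert (cancel : forall X Y (u : Hom L Y) (v : Hom X L),
    (u ∘ dag f) ∘ (f ∘ v) = u ∘ v).
  { intros X Y u v.
    now rewrite <- comp_assoc, (comp_assoc (dag f)), ff1, comp_id_l. }
  split; [exact lim_m | split].
  - intros A OA. unfold partial_isometry.
    rewrite lf, dag_comp, dag_invol, cancel, comp_assoc.
    now rewrite <- (norm A OA).
  - assert (supp : forall A,
      dag (m A) ∘ m A = f ∘ (dag (l A) ∘ l A) ∘ dag f).
    { intro A. now rewrite lf, dag_comp, dag_invol, !comp_assoc. }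
    assert (conj : forall P Q : Hom L L,
      (f ∘ P ∘ dag f) ∘ (f ∘ Q ∘ dag f) = f ∘ (P ∘ Q) ∘ dag f).
    { intros P Q. now rewrite <- (comp_assoc f Q), cancel, !comp_assoc. }
    intros A B OA OB. now rewrite !supp, !conj, (indep A B OA OB).
Qed.

Lemma unitary_of_dagger_limits (g : Hom M L) :
  weakly_initial Omega -> cone_morphism m l g ->
  g ∘ f = id L -> f ∘ g = id M ->
  is_dagger_limit Omega l -> is_dagger_limit Omega m -> unitary f.
Proof.
  intros winit lg gf fg [lim_l [norm_l indep_l]] [lim_m [norm_m indep_m]].
  assert (overlap : forall A B, Omega A -> Omega B ->
    l B ∘ dag (l A) = m B ∘ dag (m A)).
  { intros A B OA OB. apply (@overlap_eq C L M _ _ _ _ _ _ f g); auto. }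
  assert (fdag : forall A, Omega A -> f ∘ dag (l A) = dag (m A)).
  { intros A OA. apply (limit_jointly_monic lim_m).
    apply (cone_eq_weakly_initial winit
      (is_cone_comp _ (proj1 lim_m)) (is_cone_comp _ (proj1 lim_m))).
    intros B OB. rewrite comp_assoc, mf. now apply overlap. }
  assert (dag_f : dag f = g).
  { apply (limit_jointly_monic lim_l).
    apply (cone_eq_weakly_initial winit
      (is_cone_comp _ (proj1 lim_l)) (is_cone_comp _ (proj1 lim_l))).
    intros A OA. rewrite lg.
    rewrite <- (dag_invol (m A)), <- (fdag A OA).
    now rewrite dag_comp, dag_invol. }
  split; now rewrite dag_f.
Qed.

End Comparison.

Theorem theorem4p1 :
  forall (J : Category) (C : DaggerCategory) (D : Functor J C)
    (Omega : J -> Prop),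
  weakly_initial Omega ->
  (forall (L M : C) (l : forall A : J, Hom L (D A))
     (m : forall A : J, Hom M (D A)),
     is_dagger_limit Omega l ->
     is_limit m ->
     exists f : Hom L M,
       unique (fun f' : Hom L M => cone_morphism l m f') f /\
       isomorphism f /\
       (unitary f <-> is_dagger_limit Omega m)) /\
  (forall (L M : C) (l : forall A : J, Hom L (D A))
     (m : forall A : J, Hom M (D A)),
     is_dagger_limit Omega l ->
     is_dagger_limit Omega m ->
     exists f : Hom L M,
       unique (fun f' : Hom L M => cone_morphism l m f') f /\ unitary f).
Proof.
  intros J C D Omega winit.
  assert (main : forall (L M : C) (l : forall A : J, Hom L (D A))
     (m : forall A : J, Hom M (D A)),
     is_dagger_limit Omega l -> is_limit m ->
     exists f : Hom L M,
       unique (fun f' : Hom L M => cone_morphism l m f') f /\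
       isomorphism f /\ (unitary f <-> is_dagger_limit Omega m)).
  { intros L M l m dlim_l lim_m.
    destruct (limit_comparison (proj1 dlim_l) lim_m)
      as [f [g [f_uniq [lg [gf fg]]]]].
    pose proof (proj1 f_uniq) as mf.
    exists f. split; [exact f_uniq | split; [now exists g | split]].
    - intro f_unit. exact (dagger_limit_of_unitary mf f_unit dlim_l lim_m).
    - intro dlim_m.
      exact (unitary_of_dagger_limits mf winit lg gf fg dlim_l dlim_m). }
  split; [exact main|].
  intros L M l m dlim_l dlim_m.
  destruct (main L M l m dlim_l (proj1 dlim_m))
    as [f [f_uniq [_ f_unit]]].
  exists f. split; [exact f_uniq | now apply f_unit].
Qed.
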